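(* Let $\mathbb K$ be a field, let $(\kappa_n)_{n\ge1}$ be a sequence of elements of $\mathbb K$, regarded as a sequence of free cumulants, and let $(c_n)_{n\geq 1}$ be the corresponding sequence of classical cumulants. Then for every $n\ge 1$, \[-c_n=\sum_{\mathcal T\in\mathsf{Qcan}_{n-1}}(-\kappa_{\bullet+1})_{\mathbf q^{\mathcal T}},\] where $\mathsf{Qcan}_{n-1}$ is the set of quasicanonical trees on $[n-1]$, and $(-\kappa_{\bullet+1})_{\mathbf q}=\prod_{i=0}^k(-\kappa_{q_i+1})$ for $\mathbf q=(q_0,\ldots,q_k)$.
   Context: Cumulants: let $\Pi(n)$ be the set of set partitions of $[n]$, and $\mathrm{NC}(n)$ the set of noncrossing partitions of $[n]$ (no two distinct blocks $B,B'$ have $i,j\in B$, $i',j'\in B'$ with $i<i'<j<j'$ or $i>i'>j>j'$). Given the free cumulants $(\kappa_n)_{n\ge1}$, the moments are $m_n=\sum_{\eta\in\mathrm{NC}(n)}\prod_{B\in\eta}\kappa_{|B|}$, and the corresponding classical cumulants $(c_n)_{n\ge1}$ are the unique sequence in $\mathbb K$ with $m_n=\sum_{\rho\in\Pi(n)}\prod_{B\in\rho}c_{|B|}$ for all $n\ge1$. Trees: a binary plane tree is a (possibly empty) rooted tree in which each vertex has at most two children and each child is designated as a left or right child (at most one of each). A decreasing binary plane tree on a finite set $X$ of positive integers is a binary plane tree whose vertices are bijectively labeled by $X$ so that each nonroot vertex has a smaller label than its parent. For a nonempty tree $\mathcal T$ with root label $m$ and (possibly empty) left and right subtrees $\mathcal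 T_L,\mathcal T_R$ of the root, the in-order and postorder traversals are $\mathcal I(\mathcal T)=\mathcal I(\mathcal T_L)\,m\,\mathcal I(\mathcal T_R)$ and $\mathcal P(\mathcal T)=\mathcal P(\mathcal T_L)\,\mathcal P(\mathcal T_R)\,m$; both are the empty word for the empty tree. A decreasing binary plane tree is quasicanonical if every vertex $v$ that has a left child also has a nonempty right subtree $\mathcal T_v^R$ such that the first entry of $\mathcal P(\mathcal T_v^R)$ is smaller than the label of the left child of $v$. For a quasicanonical tree $\mathcal T$ with $N$ vertices, let $r_1<\cdots<r_p$ be the peaks of $\sigma=\mathcal I(\mathcal T)$, i.e. the indices $i\in\{2,\ldots,N-1\}$ with $\sigma_{i-1}<\sigma_i>\sigma_{i+1}$. Then $\mathbf q^{\mathcal T}=(r_1-1,\,r_2-r_1-1,\ldots,r_p-r_{p-1}-1,\,N-r_p)$, with $\mathbf q^{\mathcal T}=(N)$ if $p=0$ (including $N=0$ for the empty tree). *)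

(* Defs.v *)
From HB Require Import structures.
From mathcomp Require Import all_boot all_order all_algebra.

Set Implicit Arguments.
Unset Strict Implicit.
Unset Printing Implicit Defensive.

Import GRing.Theory.

(* The ground set [n] = {1, ..., n} is modelled by 'I_n = {0, ..., n-1}; the
   shift preserves the order, hence crossings. *)
Definition set_partition n (P : {set {set 'I_n}}) : bool :=
  partition P [set: 'I_n].

Definition crossing n (B B' : {set 'I_n}) : bool :=
  [exists i in B, exists j in B, exists i' in B', exists j' in B',
    ((i < i') && (i' < j) && (j < j')) || ((i > i') && (i' > j) && (j > j'))].

Definition nc_partition n (P : {set {set 'I_n}}) : bool :=
  set_partition P &&
  [forall B in P, forall B' in P, (B != B') ==> ~~ crossing B B'].

(* Sequences (a_n)_(n >= 1) are functions on nat whose value at 0 is never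
   used: blocks are nonempty. *)
Definition moment_of_free (K : fieldType) (kappa : nat -> K) (n : nat) : K :=
  (\sum_(eta : {set {set 'I_n}} | nc_partition eta)
     \prod_(B in eta) kappa #|B|)%R.

Definition moment_of_classical (K : fieldType) (c : nat -> K) (n : nat) : K :=
  (\sum_(rho : {set {set 'I_n}} | set_partition rho)
     \prod_(B in rho) c #|B|)%R.

Definition classical_cumulants_of_free (K : fieldType) (kappa c : nat -> K) :=
  forall n, 0 < n -> moment_of_free kappa n = moment_of_classical c n.

(* Node l m r has root label m, left subtree l and right subtree r. *)
Inductive btree := Leaf | Node of btree & nat & btree.

Fixpoint btree_encode (t : btree) : GenTree.tree nat :=
  if t is Node l m r then
    GenTree.Node m [:: btree_encode l; btree_encode r]
  else GenTree.Leaf 0.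

Fixpoint btree_decode (t : GenTree.tree nat) : option btree :=
  if t is GenTree.Node m [:: l; r] then
    if (btree_decode l, btree_decode r) is (Some l', Some r')
    then Some (Node l' m r') else None
  else Some Leaf.

Lemma btree_encodeK : pcancel btree_encode btree_decode.
Proof. by elim=> //= l -> m r ->. Qed.

HB.instance Definition _ := Countable.copy btree (pcan_type btree_encodeK).

Fixpoint inorder (t : btree) : seq nat :=
  if t is Node l m r then inorder l ++ m :: inorder r else [::].

Fixpoint postorder (t : btree) : seq nat :=
  if t is Node l m r then postorder l ++ postorder r ++ [:: m] else [::].

Definition root_lt (t : btree) (m : nat) : bool :=
  if t is Node _ a _ then a < m else true.

Fixpoint decreasing (t : btree) : bool :=
  if t is Node l m r then
    [&& root_lt l m, root_lt r m, decreasing l & decreasing r]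
  else true.

(* The right subtree is nonempty iff its postorder word is, so both parts of
   the condition at a vertex are read off from that word. *)
Definition quasicanonical_at (l r : btree) : bool :=
  if l is Node _ a _ then
    if postorder r is b :: _ then b < a else false
  else true.

Fixpoint quasicanonical (t : btree) : bool :=
  if t is Node l _ r then
    [&& quasicanonical_at l r, quasicanonical l & quasicanonical r]
  else true.

(* X lists the label set without repetition. *)
Definition decreasing_on (X : seq nat) (t : btree) : bool :=
  perm_eq (inorder t) X && decreasing t.

Definition qcan_on (X : seq nat) (t : btree) : bool :=
  decreasing_on X t && quasicanonical t.

Record Qcan (N : nat) :=
  MkQcan { qcan_tree :> btree; _ : qcan_on (iota 1 N) qcan_tree }.

HB.instance Definition _ N := [isSub for @qcan_tree N].
HB.instance Definition _ N := [Countable of Qcan N by <:].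

(* The decreasing trees with labels in {1, ..., N}, used only to equip Qcan N
   with its finType structure. *)
Fixpoint dtrees (N : nat) : seq btree :=
  if N is M.+1 then
    dtrees M ++ [seq Node l N r | l <- dtrees M, r <- dtrees M]
  else [:: Leaf].

Lemma mem_dtrees N t :
  decreasing t -> all (leq 1) (inorder t) -> root_lt t N.+1 -> t \in dtrees N.
Proof.
elim: N t => [|N IHN] [|l m r] //=.
- by rewrite all_cat /= => _ /and3P[_ m_gt0 _]; case: m m_gt0.
- by move=> _ _; rewrite mem_cat IHN.
case/and4P=> lm rm dl dr; rewrite all_cat /= => /and3P[pl m_gt0 pr].
rewrite ltnS mem_cat leq_eqVlt => /predU1P[Em | lt_m]; last first.
  by rewrite IHN //= ?lm ?rm ?dl ?dr // all_cat /= pl m_gt0.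
apply/orP; right; subst m; apply/allpairsP; exists (l, r).
by split; rewrite //= IHN.
Qed.

Definition qcan_enum N : seq (Qcan N) := pmap insub (undup (dtrees N)).

Lemma qcan_enumP N : Finite.axiom (qcan_enum N).
Proof.
move=> t; rewrite count_uniq_mem ?pmap_sub_uniq ?undup_uniq //.
rewrite mem_pmap_sub mem_undup mem_dtrees //; case: t => t /=.
- by case/andP=> /andP[].
- case/andP=> /andP[/perm_all-> _] _.
  by apply/allP=> i; rewrite mem_iota => /andP[].
case/andP=> /andP[/perm_mem tX _] _; case: t tX => //= l m r tX.
have: m \in inorder l ++ m :: inorder r by rewrite mem_cat mem_head orbT.
by rewrite tX mem_iota => /andP[].
Qed.

HB.instance Definition _ N := isFinite.Build (Qcan N) (@qcan_enumP N).

(* Positions are counted from 1, so the i-th entry of s is nth 0 s i.-1. *)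
Definition peaks (s : seq nat) : seq nat :=
  [seq i <- iota 2 (size s - 2) |
    (nth 0 s i.-2 < nth 0 s i.-1) && (nth 0 s i < nth 0 s i.-1)].

(* With r_0 = 0 and r_(p+1) = N + 1, the entries of q^T are
   r_(i+1) - r_i - 1 for 0 <= i <= p; this covers the case p = 0. *)
Definition qvec (t : btree) : seq nat :=
  let s := inorder t in
  pairmap (fun r r' => r' - r - 1) 0 (rcons (peaks s) (size s).+1).

(* Main.v *)
Require Import Defs.
From mathcomp Require Import all_boot all_order all_algebra.
From mathcomp Require Import zify.

(* Put u_k = - kappa_(k+1).  For an arbitrary sequence w let a_n[w] be the sum
   over the quasicanonical trees on [n], where the first entry q_0 of q^T is
   weighted by w and the other entries by u.  Write Sw for the shifted sequence
   and w.u for the Cauchy product.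

   Removing the root n+1 of a tree leaves either a right subtree alone, with q_0
   lowered by one, or a pair (L, R) for which the first postorder entry of R is
   smaller than the root of L.  The pairs which violate this condition (pairs
   with an empty component included) correspond to a tree with a cut inside its
   first segment: the first vertex of R in postorder is a leaf, it is the last
   vertex of the first segment of R, and L can be grafted below it.  Hence
     a_(n+1)[w] = a_n[Sw] + sum_k 'C(n, k) a_k[w] a_(n-k)[u] - a_n[w.u].

   Let m_n be the moments whose classical cumulants are c'_(n+1) = - a_n[u], so
   that m_(n+1) = - sum_k 'C(n, k) a_k[u] m_(n-k).  In the binomial convolution
   F_n[w] = sum_k 'C(n, k) a_k[w] m_(n-k) the quadratic terms cancel, which leaves
   the linear recursion F_(n+1)[w] = F_n[Sw - w.u].

   The same recursion governs noncrossing partitions of {0, ..., n} when the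
   block B of 0 is weighted by w_(|B|-1) and the other blocks by kappa: replace B
   by the union of B \ {0} with the block C of 1.  If C <> B, then C consists of
   the first |C| elements of the union.  For w_k = kappa_(k+1) this gives that
   the free moments are the m_n, and classical cumulants are determined by the
   moments. *)

Set Implicit Arguments.
Unset Strict Implicit.
Unset Printing Implicit Defensive.

Import GRing.Theory.
Local Open Scope ring_scope.

(** Binary trees form an infinite type, so sums over them run over duplicate-free lists; mutually
    inverse maps between the filtered lists reindex such sums. *)
Lemma big_seq_bij (K : nmodType) (I J : eqType) (r : seq I) (s : seq J)
    (P : pred I) (Q : pred J) (f : I -> J) (g : J -> I) (F : I -> K) (G : J -> K) :
    uniq r -> uniq s ->
    (forall i, i \in r -> P i ->
       [/\ f i \in s, Q (f i), g (f i) = i & F i = G (f i)]) ->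
    (forall j, j \in s -> Q j -> [/\ g j \in r, P (g j) & f (g j) = j]) ->
  \sum_(i <- r | P i) F i = \sum_(j <- s | Q j) G j.
Proof.
move=> r_uniq s_uniq fP gP; rewrite -big_filter -[RHS]big_filter.
have fPr i : i \in [seq i <- r | P i] ->
    [/\ f i \in s, Q (f i), g (f i) = i & F i = G (f i)].
  by rewrite mem_filter => /andP[Pi ri]; apply: fP.
rewrite (eq_big_seq (G \o f)) => [|i /fPr[] //]; rewrite -(big_map f xpredT).
apply/perm_big/uniq_perm; rewrite ?filter_uniq //.
  rewrite map_inj_in_uniq ?filter_uniq //; apply: (can_in_inj (g := g)).
  by move=> i /fPr[].
move=> j; rewrite mem_filter; apply/mapP/andP => [[i /fPr[? ? _ _] ->] //|].
case=> Qj sj; have [gr Pg <-] := gP j sj Qj.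
by exists (g j); rewrite // mem_filter Pg.
Qed.

(** * Binomial convolution and sums over set partitions *)

Section FiniteSums.
Variable K : comPzRingType.
Implicit Types f g h : nat -> K.

(** The coefficients of a product of exponential generating functions. *)
Definition hconv f g n := \sum_(k < n.+1) (f k * g (n - k)%N) *+ 'C(n, k).

Lemma hconv0 f g : hconv f g 0 = f 0%N * g 0%N.
Proof. by rewrite /hconv big_ord_recl big_ord0 addr0 bin0. Qed.

Lemma eq_hconv n f1 f2 g1 g2 :
    (forall k, (k <= n)%N -> f1 k = f2 k) ->
    (forall k, (k <= n)%N -> g1 k = g2 k) ->
  hconv f1 g1 n = hconv f2 g2 n.
Proof.
by move=> f12 g12; apply: eq_bigr => -[k ?] _ /=; rewrite f12 // g12 ?leq_subr.
Qed.

Lemma hconvDl f1 f2 g n :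
  hconv (fun k => f1 k + f2 k) g n = hconv f1 g n + hconv f2 g n.
Proof. by rewrite -big_split; apply: eq_bigr => k _; rewrite mulrDl mulrnDl. Qed.

Lemma hconvDr f g1 g2 n :
  hconv f (fun k => g1 k + g2 k) n = hconv f g1 n + hconv f g2 n.
Proof. by rewrite -big_split; apply: eq_bigr => k _; rewrite mulrDr mulrnDl. Qed.

Lemma hconvNl f g n : hconv (fun k => - f k) g n = - hconv f g n.
Proof. by rewrite -sumrN; apply: eq_bigr => k _; rewrite mulNr mulNrn. Qed.

Lemma hconvNr f g n : hconv f (fun k => - g k) n = - hconv f g n.
Proof. by rewrite -sumrN; apply: eq_bigr => k _; rewrite mulrN mulNrn. Qed.

(* The Leibniz rule for exponential generating functions, whose derivative is
   the shift of the sequence. *)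
Lemma hconvS f g n :
  hconv f g n.+1 = hconv (fun k => f k.+1) g n + hconv f (fun k => g k.+1) n.
Proof.
rewrite {1}/hconv big_ord_recl bin0 subn0.
under eq_bigr do rewrite lift0 binS mulrnDr.
rewrite big_split /= addrA addrC; congr (_ + _).
rewrite big_ord_recr /= bin_small // mulr0n addr0.
rewrite /hconv [RHS]big_ord_recl bin0 subn0; congr (_ + _).
by apply: eq_bigr => k _; rewrite lift0 subSS subnSK.
Qed.

(** By the Leibniz rule both sides satisfy the same recursion in [n]. *)
Lemma hconvA f g h n : hconv (hconv f g) h n = hconv f (hconv g h) n.
Proof.
elim: n f g h => [|n IHn] f g h; first by rewrite !hconv0 mulrA.
rewrite !hconvS.
rewrite (eq_hconv (fun k _ => hconvS f g k) (fun k _ => erefl (h k))) hconvDl.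
rewrite (eq_hconv (fun k _ => erefl (f k)) (fun k _ => hconvS g h k)) hconvDr.
by rewrite !IHn addrA.
Qed.

Lemma sum_subset_card (T : finType) (A : {set T}) (g : nat -> K) :
  \sum_(Y : {set T} | Y \subset A) g #|Y| = \sum_(k < #|A|.+1) g k *+ 'C(#|A|, k).
Proof.
rewrite (partition_big (fun Y : {set T} => inord #|Y| : 'I_#|A|.+1) xpredT) //=.
apply: eq_bigr => k _; rewrite -cards_draws -sumr_const.
apply: eq_big => [Y|Y /andP[YA /eqP<-]]; last by rewrite inordK // ltnS subset_leq_card.
rewrite inE; case YA: (Y \subset A) => //=.
by rewrite -(inj_eq val_inj) /= inordK // ltnS subset_leq_card.
Qed.

Lemma sum_subset_hconv (T : finType) (A : {set T}) (f g : nat -> K) :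
  \sum_(Y : {set T} | Y \subset A) f #|Y| * g #|A :\: Y| = hconv f g #|A|.
Proof.
apply: etrans (sum_subset_card A (fun k => f k * g (#|A| - k)%N)).
by apply: eq_bigr => Y YA; rewrite cardsD (setIidPr YA).
Qed.

(** Partitions are classified by the block [C] of [x]. The predicate [Phi] carries a side condition
    on the whole partition: trivial for classical moments, noncrossing for free ones. *)
Lemma sum_partition_block (T : finType) (f : {set T} -> K)
    (Phi : pred {set {set T}}) (A : {set T}) x : x \in A ->
  \sum_(P : {set {set T}} | partition P A && Phi P) \prod_(B in P) f B =
  \sum_(C : {set T} | (C \subset A) && (x \in C)) f C *
     \sum_(Q : {set {set T}} | partition Q (A :\: C) && Phi (C |: Q))
        \prod_(B in Q) f B.
Proof.
move=> Ax; rewrite (partition_big (fun P : {set {set T}} => pblock P x)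
  (fun C : {set T} => (C \subset A) && (x \in C))) /=; last first.
  move=> P /andP[partP _]; have covP := cover_partition partP.
  by rewrite mem_pblock covP Ax andbT (partitionS partP) ?pblock_mem ?covP.
apply: eq_bigr => C /andP[CA Cx].
have notin Q : partition Q (A :\: C) -> C \notin Q.
  move=> partQ; apply/negP => /(partitionS partQ)/subsetP/(_ x Cx).
  by rewrite inE Cx.
rewrite (reindex_onto (fun Q => C |: Q) (fun P => P :\ C)) /=; last first.
  move=> P /andP[/andP[partP _] /eqP<-]; rewrite setD1K // pblock_mem //.
  by rewrite (cover_partition partP).
rewrite big_distrr /=; apply: eq_big => [Q|Q /andP[/andP[/andP[partQ _] _] /eqP QC]].
  apply/idP/idP => [/andP[/andP[/andP[partQ ->] _] /eqP QC]|].
    by rewrite -QC (partitionD1 partQ) ?setU11.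
  case/andP=> partQ ->; have CQ := notin _ partQ.
  have partCQ : partition (C |: Q) A.
    have -> : A = C :|: A :\: C by rewrite -{1}(setID A C) (setIidPr CA).
    apply: partitionU1 => //; first by apply/set0Pn; exists x.
    by rewrite disjoint_sym disjoints_subset setDE subsetIr.
  rewrite partCQ setU1K // eqxx andbT /=.
  by rewrite (def_pblock (partition_trivIset partCQ) _ Cx) ?setU11.
have CQ : C \notin Q by rewrite -QC !inE eqxx.
by rewrite (big_setU1 _ CQ).
Qed.
End FiniteSums.

Lemma sum_subset_mem (K : nmodType) (T : finType) (A : {set T}) x
    (F : {set T} -> K) : x \in A ->
  \sum_(C : {set T} | (C \subset A) && (x \in C)) F C =
  \sum_(Y : {set T} | Y \subset A :\ x) F (x |: Y).
Proof.
move=> Ax; rewrite (reindex_onto (fun Y => x |: Y) (fun C => C :\ x)) /=.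
  apply: eq_bigl => Y; rewrite setU11 andbT subUset sub1set Ax subsetD1 /=.
  congr (_ && _); apply/eqP/idP => [<-|/setU1K //]; first by rewrite !inE eqxx.
by move=> C /andP[_ Cx]; rewrite setD1K.
Qed.

(** * Classical moments *)

Section ClassicalMoments.
Variables (K : fieldType) (c : nat -> K).
Local Notation m := (moment_of_classical c).

Lemma moment_of_classical0 : m 0 = 1.
Proof.
rewrite /moment_of_classical (big_pred1 set0) ?big_set0 // => P.
by rewrite /set_partition (_ : [set: _] = set0) ?partition_set0 //; apply/setP => -[].
Qed.

(** The block of one element is split off. The assumption on smaller sets is an induction
    hypothesis, so that the lemma can serve inside the induction of [sum_partition_moment]. *)
Lemma sum_partition_hconv n (T : finType) (A : {set T}) : #|A| = n.+1 ->
    (forall B : {set T}, (#|B| <= n)%N ->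
       \sum_(P | partition P B) \prod_(E in P) c #|E| = m #|B|) ->
  \sum_(P | partition P A) \prod_(B in P) c #|B| = hconv (fun k => c k.+1) m n.
Proof.
move=> cardA IH; have /card_gt0P[x Ax] : (0 < #|A|)%N by rewrite cardA.
have cardAx : #|A :\ x| = n by move: (cardsD1 x A); rewrite Ax cardA; case.
rewrite -cardAx -sum_subset_hconv.
under eq_bigl do rewrite -[partition _ _]andbT.
rewrite (sum_partition_block (fun B => c #|B|) xpredT Ax) sum_subset_mem //.
apply: eq_bigr => Y; rewrite cardsU1 subsetD1 => /andP[_ ->]; congr (_ * _).
under eq_bigl do rewrite andbT.
by rewrite -setDDl IH // -cardAx subset_leq_card // subsetDl.
Qed.

Lemma sum_partition_moment (T : finType) (A : {set T}) :
  \sum_(P : {set {set T}} | partition P A) \prod_(B in P) c #|B| = m #|A|.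
Proof.
have [n] := ubnP #|A|; elim: n T A => // n IHn T A.
case cardA: #|A| => [|k]; rewrite ltnS => le_k_n.
  rewrite (cards0_eq cardA) moment_of_classical0 (big_pred1 set0) ?big_set0 // => P.
  exact: partition_set0.
rewrite (sum_partition_hconv cardA) => [|B le_B_k]; last by rewrite IHn //; lia.
(* The same recursion is read backwards for the full set of ordinals, whose partition sum is
   [m k.+1]. *)
rewrite -(@sum_partition_hconv _ _ [set: 'I_k.+1]) ?cardsT ?card_ord // => B leB.
by rewrite IHn //; lia.
Qed.

Lemma moment_of_classicalS n : m n.+1 = hconv (fun k => c k.+1) m n.
Proof.
rewrite -(@sum_partition_hconv _ _ [set: 'I_n.+1]) ?cardsT ?card_ord // => B _.
exact: sum_partition_moment.
Qed.

End ClassicalMoments.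

(** In the recursion for the moment of index [n.+1], the cumulant of that index has coefficient 1,
    and all other terms involve earlier cumulants. *)
Lemma eq_classical_cumulants (K : fieldType) (c1 c2 : nat -> K) :
    (forall n, (0 < n)%N -> moment_of_classical c1 n = moment_of_classical c2 n) ->
  forall n, (0 < n)%N -> c1 n = c2 n.
Proof.
move=> eq_m [//|n] _.
have {}eq_m n' : moment_of_classical c1 n' = moment_of_classical c2 n'.
  by case: n' => [|n']; rewrite ?moment_of_classical0 ?eq_m.
elim/ltn_ind: n => n IHn; have := eq_m n.+1; rewrite !moment_of_classicalS.
rewrite /hconv !big_ord_recr /= !subnn !moment_of_classical0 !binn !mulr1n !mulr1.
rewrite (eq_bigr (fun k : 'I_n =>
  (c2 k.+1 * moment_of_classical c2 (n - k)%N) *+ 'C(n, k))) => [/addrI //|k _].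
by rewrite IHn // eq_m.
Qed.

Definition cauchy_prod (K : pzSemiRingType) (w u : nat -> K) k :=
  \sum_(i < k.+1) w (k - i)%N * u i.

(** * Noncrossing partitions *)

Section Crossing.
Variable N : nat.
Implicit Types (x y : 'I_N) (B C D E : {set 'I_N}) (P Q : {set {set 'I_N}}).

(** Detached from the partition condition, so that it applies to [B |: Q] when only [Q] is summed
    over. *)
Definition noncrossing P :=
  [forall B in P, forall B' in P, (B != B') ==> ~~ crossing B B'].

Lemma crossingP B B' :
  reflect (exists i j i' j', [/\ i \in B, j \in B, i' \in B', j' \in B' &
    ((i < i') && (i' < j) && (j < j') || (i > i') && (i' > j) && (j > j'))%N])
    (crossing B B').
Proof.
apply: (iffP 'exists_in_'exists_in_'exists_in_'exists_in_idP) => [[i Bi]|].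
  by case=> j Bj [i' Bi'] [j' Bj' ?]; exists i, j, i', j'.
case=> i [j] [i'] [j'] [? ? ? ? ?].
by exists i; last exists j; last exists i'; last exists j'.
Qed.

Lemma crossing_sym B B' : crossing B B' = crossing B' B.
Proof.
(* Reading the four points backwards exchanges the two blocks and the two alternatives. *)
by apply/crossingP/crossingP => -[i [j [i' [j' [? ? ? ?]]]]] H;
  exists j', i', j, i; split=> //; lia.
Qed.

Lemma crossingS B D E : B \subset D -> crossing B E -> crossing D E.
Proof.
move=> /subsetP BD /crossingP[i [j [i' [j' [Bi Bj ? ? ?]]]]].
by apply/crossingP; exists i, j, i', j'; split=> //; apply: BD.
Qed.

Lemma noncrossingU1 B Q : B \notin Q ->
  noncrossing (B |: Q) = noncrossing Q && [forall E in Q, ~~ crossing B E].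
Proof.
move=> BQ; apply/'forall_in_'forall_in_implyP/andP => [nc|[]].
  split; first by apply/'forall_in_'forall_in_implyP => C QC D QD;
    apply: nc; rewrite inE (QC, QD) orbT.
  apply/'forall_in_idP => E QE; apply: nc; rewrite ?setU11 // ?setU1r //.
  by apply: contraNneq BQ => ->.
move=> /'forall_in_'forall_in_implyP ncQ /'forall_in_idP ncB C /setU1P[->|QC] D.
  by case/setU1P=> [->|QD _]; rewrite ?eqxx //; apply: ncB.
by case/setU1P=> [-> _|QD]; [rewrite crossing_sym; apply: ncB | apply: ncQ].
Qed.

Definition before C D := [forall a in C, forall d in D, (a < d)%N].

Section Successor.
Variables x y : 'I_N.
Hypothesis xy : y = x.+1 :> nat.

(** No element of [E] separates [x] from [y], so a crossing that uses [x] can use [y] instead. *)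
Lemma crossingU1 D E : (forall e, e \in E -> (y < e)%N) -> y \in D ->
  crossing (x |: D) E = crossing D E.
Proof.
move=> ltyE Dy; apply/idP/idP; last exact/crossingS/subsetUr.
case/crossingP=> i [j [i' [j' [/setU1P Di /setU1P Dj Ei' Ej' lt]]]].
have [lti ltj] := (ltyE _ Ei', ltyE _ Ej'); apply/crossingP.
case: Dj => [Dj|Dj]; first by subst j; lia.
case: Di => [Di|Di]; last by exists i, j, i', j'.
by exists y, j, i', j'; split=> //; subst i; lia.
Qed.

(** If some [d] in [D] precedes some [a] in [C], then [x < y < d < a] alternate between the blocks.
    Conversely, every crossing puts an element of [D] before one of [C]. *)
Lemma crossing_before C D : y \in C -> y \notin D ->
    [disjoint C & D] ->
    (forall e, e \in C :|: D -> (y <= e)%N) ->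
  crossing (x |: D) C = ~~ before C D.
Proof.
move=> Cy Dy CD leyE; apply/crossingP/negP; last first.
  move/negP; rewrite negb_forall_in => /exists_inP[a Ca].
  rewrite negb_forall_in => /exists_inP[d Dd ltad].
  exists x, d, y, a; split; rewrite ?setU11 ?setU1r //.
  have ya : (y <= d)%N by apply: leyE; rewrite inE Dd orbT.
  have : d != y by apply: contraNneq Dy => <-.
  have : d != a by apply: contraTneq Dd => ->; rewrite (disjointFr CD).
  rewrite -!val_eqE /=; lia.
case=> i [j [i' [j' [/setU1P Di /setU1P Dj Ci' Cj' lt]]]].
move/'forall_in_'forall_in_idP => bef.
have := (leyE i', leyE j'); rewrite !inE Ci' Cj' => -[/(_ isT) ? /(_ isT) ?].
case: Dj => [Dj|Dj]; first by subst j; lia.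
have [? ?] := (bef _ Ci' _ Dj, bef _ Cj' _ Dj); lia.
Qed.

(** In a crossing with one point in each part, the extreme one of the two is replaced by [x] if it
    lies in [C] and by [y] if it lies in [D]; both [x] and [y] are to the left of [E]. *)
Lemma crossingU C D E : (forall e, e \in E -> (y < e)%N) -> y \in C ->
    before C D ->
  crossing (C :|: D) E = crossing C E || crossing (x |: D) E.
Proof.
move=> ltyE Cy /'forall_in_'forall_in_idP bef; apply/idP/orP => [|[]]; last 2 first.
- exact/crossingS/subsetUl.
- move=> cr; rewrite -crossingU1 // ?inE ?Cy //; apply: crossingS cr.
  by rewrite setUS // subsetUr.
case/crossingP=> i [j [i' [j' [CDi CDj Ei' Ej' lt]]]].
have [lti ltj] := (ltyE _ Ei', ltyE _ Ej').
case/setUP: CDi => [Ci|Di]; case/setUP: CDj => [Cj|Dj].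
- by left; apply/crossingP; exists i, j, i', j'.
- case/orP: lt => lt; last by have := bef _ Ci _ Dj; lia.
  right; apply/crossingP; exists x, j, i', j'; rewrite setU11 setU1r //; split=> //; lia.
- have := bef _ Cj _ Di => ji; case/orP: lt => lt; first by lia.
  left; apply/crossingP; exists y, j, j', i'; split=> //; lia.
by right; apply/crossingP; exists i, j, i', j'; rewrite !setU1r.
Qed.

End Successor.

(** The sets [C] are the nonempty initial segments of [B], one of each size. In the induction the
    largest element [z] of [B] is removed: a segment that contains it is all of [B]. *)
Lemma sum_initial (K : nmodType) y B (g : nat -> K) :
    y \in B -> (forall e, e \in B -> (y <= e)%N) ->
  \sum_(C : {set 'I_N} | [&& C \subset B, y \in C & before C (B :\: C)]) g #|C| =
  \sum_(i < #|B|) g i.+1.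
Proof.
have [n] := ubnP #|B|; elim: n B => // n IHn B; rewrite ltnS => leBn By leyB.
case: (arg_maxnP (fun i : 'I_N => val i) By) => /= z Bz maxz.
have {}Bz : z \in B by [].
have {}maxz d : d \in B -> (d <= z)%N by move=> Bd; apply: maxz.
have cardB := cardsD1 z B; rewrite Bz add1n in cardB.
rewrite (bigID (fun C : {set 'I_N} => z \in C)) /= (big_pred1 B) => [|C]; last first.
  apply/andP/eqP => [[/and3P[CB Cy /'forall_in_'forall_in_idP bef] Cz]|->].
    apply/eqP; rewrite eqEsubset CB; apply/subsetP => d Bd.
    apply: contraT => Cd; have := bef z Cz d; rewrite !inE Cd Bd => /(_ isT).
    by have := maxz d Bd; lia.
  split=> //; apply/and3P; split=> //; apply/'forall_in_'forall_in_idP => a _ d.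
  by rewrite setDv inE.
rewrite addrC cardB big_ord_recr /=; congr (_ + _).
have [zy|zy] := eqVneq z y.
  rewrite big1 => [|C /andP[/and3P[_ + _]]]; last by rewrite zy => ->.
  rewrite (_ : #|B :\ z| = 0%N) ?big_ord0 //; apply: eq_card0 => e; rewrite !inE.
  apply/negP => /andP[ez Be]; have := maxz e Be; have := leyB e Be.
  by move: ez; rewrite zy -val_eqE /=; lia.
rewrite -IHn; first last.
- by move=> e; rewrite inE => /andP[_ /leyB].
- by rewrite !inE eq_sym zy.
- by rewrite -cardB.
apply: eq_bigl => C; rewrite subsetD1 -!andbA; case CB: (C \subset B) => //=.
case Cy: (y \in C); rewrite ?andbF //=; rewrite andbC; case Cz: (z \in C) => //=.
apply/'forall_in_'forall_in_idP/'forall_in_'forall_in_idP => bef a Ca d.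
  by rewrite !inE => /and3P[dC dz dB]; apply: bef => //; rewrite inE dC.
rewrite inE => /andP[dC dB]; have [->|dz] := eqVneq d z; last first.
  by apply: bef => //; rewrite !inE dC dz.
have az : a != z by apply: contraFneq Cz => <-.
by rewrite ltn_neqAle val_eqE az maxz // (subsetP CB).
Qed.

End Crossing.

(** * Noncrossing sums with a separate weight for the first block *)

Section FreeMoments.
Variables (K : fieldType) (kappa : nat -> K) (N : nat).
Implicit Types (x y : 'I_N) (B C D E : {set 'I_N}) (P Q : {set {set 'I_N}}).

Local Notation u := (fun k : nat => - kappa k.+1).

Definition up x : {set 'I_N} := [set i : 'I_N | (x <= i)%N].

Definition nc_completions x B : K :=
  \sum_(Q : {set {set 'I_N}} | partition Q (up x :\: B) && noncrossing (B |: Q))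
     \prod_(E in Q) kappa #|E|.

Definition nc_sum x (w : nat -> K) : K :=
  \sum_(B : {set 'I_N} | (B \subset up x) && (x \in B))
     w #|B|.-1 * nc_completions x B.

Lemma nc_sum_last x w : x.+1 = N -> nc_sum x w = w 0%N.
Proof.
move=> xN; have upx : up x = [set x].
  apply/setP => i; rewrite !inE -val_eqE /=; have := ltn_ord i; lia.
rewrite /nc_sum (big_pred1 [set x]) => [|B]; last first.
  rewrite upx subset1 /=; case: eqVneq => [->|_] /=; first by rewrite set11.
  by case: eqVneq => [->|//]; rewrite inE.
rewrite cards1 /nc_completions upx setDv (big_pred1 set0) ?big_set0 ?mulr1 // => Q.
rewrite partition_set0 /=; case: (Q =P set0) => //= ->; rewrite setU0.
apply/'forall_in_'forall_in_implyP => B /set1P-> C /set1P->.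
by rewrite eqxx.
Qed.

Section Step.
Variables x y : 'I_N.
Hypothesis xy : y = x.+1 :> nat.

Lemma up_succ : up x :\ x = up y.
Proof. by apply/setP => i; rewrite !inE -val_eqE /= xy; lia. Qed.

Lemma notin_up : x \notin up y.
Proof. by rewrite inE xy ltnn. Qed.

Lemma partition_notin Q A B z : partition Q A -> z \in B -> z \notin A -> B \notin Q.
Proof.
by move=> pQ Bz; apply: contraNN => /(partitionS pQ)/subsetP; apply.
Qed.

Lemma up_gt D : y \in D -> forall Q, partition Q (up y :\: D) ->
  forall E, E \in Q -> forall e, e \in E -> (y < e)%N.
Proof.
move=> Dy Q pQ E QE e Ee; have /subsetP/(_ e Ee) := partitionS pQ QE.
rewrite !inE ltn_neqAle => /andP[De ->]; rewrite andbT val_eqE.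
by apply: contraNneq De => <-.
Qed.

Lemma nc_completions_mem D : D \subset up y -> y \in D ->
  nc_completions x (x |: D) = nc_completions y D.
Proof.
move=> sD Dy; apply: eq_bigl => Q; rewrite -setDDl up_succ.
apply: andb_id2l => pQ.
rewrite !noncrossingU1; first 1 last.
- by apply: (partition_notin pQ Dy); rewrite !inE Dy.
- by apply: (partition_notin pQ (setU11 x D)); rewrite inE negb_and notin_up orbT.
congr (_ && _); apply: eq_forallb => E; apply: implyb_id2l => QE.
by rewrite (crossingU1 xy (up_gt Dy pQ QE)).
Qed.

(** The blocks [x |: D] and [C] do not cross exactly when [C] precedes [D]; then another block
    crosses one of them iff it crosses the union, so merging them loses nothing. *)
Lemma noncrossing_split C D Q :
    C \subset up y :\: D -> D \subset up y -> y \in C ->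
    partition Q (up y :\: (C :|: D)) ->
  noncrossing ((x |: D) |: (C |: Q)) = before C D && noncrossing ((C :|: D) |: Q).
Proof.
rewrite subsetD => /andP[sC CD] sD Cy pQ; have Dy := disjointFr CD Cy.
have xup (A : {set 'I_N}) : A \subset up y -> x \notin A.
  by move=> sA; apply: contraNN notin_up => /(subsetP sA).
have [CQ xQ CDQ] : [/\ C \notin Q, x |: D \notin Q & C :|: D \notin Q].
  split; [apply: (partition_notin pQ Cy)|apply: (partition_notin pQ (setU11 x D))|].
  - by rewrite !inE Cy.
  - by rewrite xup // subsetDl.
  by apply: (partition_notin pQ (z := y)); rewrite !inE Cy.
rewrite !noncrossingU1 //; last first.
  rewrite !inE negb_or xQ andbT; apply: contraNneq (xup C sC) => <-.
  by rewrite setU11.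
have -> (p : pred {set 'I_N}) :
    [forall E in C |: Q, p E] = p C && [forall E in Q, p E].
  apply/'forall_in_idP/andP => [pCQ|[pC /'forall_in_idP pQ'] E].
    by split; [|apply/'forall_in_idP => E QE]; apply: pCQ; rewrite !inE ?eqxx ?QE ?orbT.
  by case/setU1P=> [->|/pQ'].
rewrite (crossing_before xy Cy) ?Dy // => [|e]; last first.
  by case/setUP=> [/(subsetP sC)|/(subsetP sD)]; rewrite inE.
rewrite negbK; case bef: (before C D); rewrite ?andbF //= -andbA; congr (_ && _).
have CDy : y \in C :|: D by rewrite inE Cy.
apply/andP/'forall_in_idP => [[/'forall_in_idP ncC /'forall_in_idP ncD] E QE|nc].
  by rewrite (crossingU xy (up_gt CDy pQ QE) Cy bef) negb_or ncC ?ncD.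
by split; apply/'forall_in_idP => E QE; have := nc E QE;
  rewrite (crossingU xy (up_gt CDy pQ QE) Cy bef) negb_or => /andP[].
Qed.

Lemma nc_completions_notin D : D \subset up y -> y \notin D ->
  nc_completions x (x |: D) =
  \sum_(C : {set 'I_N} | [&& C \subset up y :\: D, y \in C & before C D])
     kappa #|C| * nc_completions y (C :|: D).
Proof.
move=> sD Dy; rewrite /nc_completions -setDDl up_succ.
rewrite (sum_partition_block (fun E => kappa #|E|)
  (fun Q => noncrossing ((x |: D) |: Q)) (x := y)) ?inE ?leqnn ?Dy //.
rewrite (bigID (fun C => before C D)) /= [X in _ + X]big1 ?addr0 => [|C].
  apply: eq_big => [C|C /andP[/andP[sC Cy] bef]]; first by rewrite andbA.
  congr (_ * _); apply: eq_bigl => Q; rewrite setDDl [D :|: C]setUC.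
  by apply: andb_id2l => pQ; rewrite noncrossing_split // bef.
case/andP=> /andP[sC Cy] /negbTE bef; rewrite big_pred0 ?mulr0 // => Q.
rewrite setDDl [D :|: C]setUC; apply/negP => /andP[pQ].
by rewrite noncrossing_split // bef.
Qed.

(** If [y] lies in the block of [x], deleting [x] shifts [w]. Otherwise that block is merged with
    the block of [y], and the sum over initial segments is [- cauchy_prod w u], the sign coming from
    [u]. *)
Lemma nc_sum_step w :
  nc_sum x w = nc_sum y (fun k => w k.+1 - cauchy_prod w u k).
Proof.
rewrite {1}/nc_sum sum_subset_mem ?inE // up_succ (bigID (fun D => y \in D)) /=.
pose G C D := w #|D| * kappa #|C| * nc_completions y (C :|: D).
have -> : \sum_(D : {set 'I_N} | (D \subset up y) && (y \notin D))
    w #|x |: D|.-1 * nc_completions x (x |: D) =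
    \sum_(B : {set 'I_N} | (B \subset up y) && (y \in B))
      (\sum_(i < #|B|) w (#|B| - i.+1)%N * kappa i.+1) * nc_completions y B.
  transitivity (\sum_(D : {set 'I_N} | (D \subset up y) && (y \notin D))
     \sum_(C : {set 'I_N} | [&& C \subset up y :\: D, y \in C & before C D]) G C D).
    apply: eq_bigr => D /andP[sD Dy]; rewrite nc_completions_notin // big_distrr /=.
    apply: eq_bigr => C _; rewrite mulrA cardsU1.
    by rewrite (contraNN (subsetP sD x) notin_up).
  transitivity (\sum_(B : {set 'I_N} | (B \subset up y) && (y \in B))
     \sum_(C : {set 'I_N} | [&& C \subset B, y \in C & before C (B :\: C)])
        G C (B :\: C)).
    rewrite !pair_big_dep /=.
    (* The pair [(D, C)] is exchanged for the merged block [B = C :|: D] with its initial segment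
       [C]. *)
    rewrite (reindex_onto (fun p => (p.1 :\: p.2, p.2)) (fun p => (p.2 :|: p.1, p.2))) /=.
      apply: eq_bigl => -[B C] /=; rewrite xpair_eqE eqxx andbT.
      apply/andP/andP => [[/andP[/andP[sD _] /and3P[sC Cy bef]] /eqP CB]|].
        have CsB : C \subset B by rewrite -CB subsetUl.
        rewrite (subsetP CsB) // CsB Cy bef -CB subUset sD !andbT; split=> //.
        by apply: subset_trans sC (subsetDl _ _).
      case=> /andP[sB By] /and3P[CB Cy bef].
      rewrite (subset_trans (subsetDl _ _) sB) inE Cy bef /= subsetD.
      rewrite (subset_trans CB sB) /= disjoint_sym disjoints_subset setDE subsetIr.
      by rewrite -setDE -{2}(setID B C) (setIidPr CB).
    case=> D C /= /andP[_ /and3P[]]; rewrite subsetD => /andP[_ CD] _ _.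
    by congr (_, _); rewrite setDUl setDv set0U; apply/setDidPl; rewrite disjoint_sym.
  apply: eq_bigr => B /andP[sB By].
  rewrite -(sum_initial (fun k => w (#|B| - k)%N * kappa k) By) => [|e Be]; last first.
    by have := subsetP sB e Be; rewrite inE.
  rewrite big_distrl /=; apply: eq_bigr => C /and3P[CB _ _].
  have -> : G C (B :\: C) =
      w #|B :\: C| * kappa #|C| * nc_completions y (B :&: C :|: B :\: C).
    by rewrite (setIidPr CB).
  by rewrite setID cardsD (setIidPr CB).
rewrite -big_split /=; apply: eq_bigr => D /andP[sD Dy].
rewrite nc_completions_mem // -mulrDl cardsU1 (contraNN (subsetP sD x) notin_up).
have : (0 < #|D|)%N by apply/card_gt0P; exists y.
case: #|D| => //= k _; rewrite /cauchy_prod -sumrN; congr ((_ + _) * _).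
by apply: eq_bigr => i _; rewrite mulrN opprK subSS.
Qed.

End Step.

(** The function [F] is left abstract so that a sum over trees can be substituted; going from [x] to
    the last element takes [N - x.+1] steps. *)
Lemma nc_sum_iter (F : nat -> (nat -> K) -> K) :
    (forall w, F 0%N w = w 0%N) ->
    (forall n w, F n.+1 w = F n (fun k => w k.+1 - cauchy_prod w u k)) ->
  forall x w, nc_sum x w = F (N - x.+1)%N w.
Proof.
move=> F0 FS x; move defn: (N - x.+1)%N => n.
elim: n x defn => [|n IHn] x defn w; have ltxN := ltn_ord x.
  by rewrite F0 nc_sum_last //; lia.
have ltyN : (x.+1 < N)%N by lia.
rewrite (@nc_sum_step x (Ordinal ltyN)) // FS IHn //=; lia.
Qed.

End FreeMoments.

Lemma moment_of_freeS (K : fieldType) (kappa : nat -> K) n :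
  moment_of_free kappa n.+1 =
  nc_sum kappa (ord0 : 'I_n.+1) (fun k => kappa k.+1).
Proof.
rewrite /moment_of_free /nc_partition /set_partition.
rewrite (sum_partition_block (fun B => kappa #|B|) (@noncrossing n.+1) (in_setT ord0)).
have up0 : up (ord0 : 'I_n.+1) = setT by apply/setP => i; rewrite !inE.
rewrite /nc_sum up0; apply: eq_bigr => B /andP[_ B0].
rewrite prednK; last by apply/card_gt0P; exists ord0.
by rewrite /nc_completions up0.
Qed.

(** * Peaks and segments of quasicanonical trees *)

(** Here [k] is the position of the second letter of [s]; hence [peaks] is the case [k = 2]. *)
Fixpoint peaks_from k (s : seq nat) : seq nat :=
  if s is a :: s' then
    if s' is b :: (c :: _) then
      if ((a < b) && (c < b))%N then k :: peaks_from k.+1 s' else peaks_from k.+1 s'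
    else [::]
  else [::].

Lemma peaks_from_cons k a b c s :
  peaks_from k [:: a, b, c & s] =
  (if (a < b) && (c < b) then [:: k] else [::])%N ++ peaks_from k.+1 [:: b, c & s].
Proof. by rewrite [LHS]/=; case: ifP. Qed.

Lemma peaks_fromE k s :
  peaks_from k s = [seq (k + j)%N | j <- iota 0 (size s - 2) &
    (nth 0 s j < nth 0 s j.+1) && (nth 0 s j.+2 < nth 0 s j.+1)]%N.
Proof.
elim: s k => // a [|b [|c s]] // IHs k; rewrite peaks_from_cons IHs.
have -> : (size [:: a, b, c & s] - 2 = 1 + (size [:: b, c & s] - 2))%N.
  by rewrite /= !subSS !subn0 add1n.
rewrite iotaD filter_cat map_cat; congr (_ ++ _).
  by rewrite /=; case: ifP; rewrite /= ?addn0.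
rewrite add0n -[1%N in RHS]addn0 iotaDl filter_map -map_comp.
by apply: eq_map => j /=; rewrite addSnnS.
Qed.

Lemma peaksE s : peaks s = peaks_from 2 s.
Proof. by rewrite peaks_fromE /peaks -[2%N in LHS]addn0 iotaDl filter_map. Qed.

Lemma peaks_from_shift k j s :
  peaks_from (j + k) s = [seq (j + i)%N | i <- peaks_from k s].
Proof.
by rewrite !peaks_fromE -map_comp; apply: eq_map => i /=; rewrite addnA.
Qed.

Lemma peaks_from_max k m s : all (fun i => i < m)%N s ->
  peaks_from k (m :: s) = peaks_from k.+1 s.
Proof. by case: s => [|b [|c s]] //= /andP[bm _]; rewrite ltnNge ltnW. Qed.

(** The large letter [m] is a peak at position [k + size s] and keeps its neighbours from being
    peaks, so the peaks of the two words are unaffected. *)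
Lemma peaks_from_cat k m a s b s' :
    all (fun i => i < m)%N (a :: s) -> all (fun i => i < m)%N (b :: s') ->
  peaks_from k ((a :: s) ++ m :: b :: s') =
  peaks_from k (a :: s) ++ (k + size s)%N :: peaks_from (k + size s).+2 (b :: s').
Proof.
move=> ltsm lts'm; elim: s a k ltsm => [|c s IHs] a k /andP[am ltsm].
  have [bm _] := andP lts'm; rewrite addn0 cat1s peaks_from_cons am bm.
  by rewrite (peaks_from_max _ lts'm).
have [cm _] := andP ltsm; rewrite [size _]/= -addSnnS.
case: s ltsm IHs => [|d s] ltsm IHs.
  rewrite 2!cat_cons cat0s peaks_from_cons [(m < c)%N]ltnNge (ltnW cm) andbF cat0s.
  by rewrite -cat1s IHs.
by rewrite 3!cat_cons peaks_from_cons -2!cat_cons IHs // catA -peaks_from_cons.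
Qed.

(** * Weights of trees, grafting and cutting *)

Section Weights.
Variables (K : comPzRingType) (u : nat -> K).

Lemma btree_left_ind (P : btree -> Prop) :
    P Leaf -> (forall m r, P r -> P (Node Leaf m r)) ->
    (forall l m r, l != Leaf -> P l -> P r -> P (Node l m r)) ->
  forall t, P t.
Proof.
move=> PL P1 P2; elim=> // l Pl m r Pr.
by have [->|] := eqVneq l Leaf; [apply: P1 | move=> ?; apply: P2].
Qed.

(** For decreasing quasicanonical trees this is the first entry of q^T, and [tail_weight] is the
    product of [u] over the other entries; see [qvec_weight]. *)
Fixpoint seg0 t : nat :=
  if t is Node l _ r then if l is Leaf then (seg0 r).+1 else seg0 l else 0%N.

Fixpoint tail_weight t : K :=
  if t is Node l _ r then
    if l is Leaf then tail_weight r
    else tail_weight l * (u (seg0 r) * tail_weight r)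
  else 1.

Definition weight (w : nat -> K) t := w (seg0 t) * tail_weight t.

(* The path followed here ends at the first vertex of t in postorder when t is
   quasicanonical; s becomes its right subtree. *)
Fixpoint graft t s : btree :=
  if t is Node l m r then
    if l is Leaf then Node Leaf m (graft r s) else Node (graft l s) m r
  else s.

(* The inverse of graft: the edge below the i-th vertex of the first segment is
   cut, and the upper part comes first. *)
Fixpoint cut t i : btree * btree :=
  match i, t with
  | 0%N, _ => (Leaf, t)
  | _, Leaf => (Leaf, Leaf)
  | i'.+1, Node l m r =>
      if l is Leaf then let p := cut r i' in (Node Leaf m p.1, p.2)
      else let p := cut l i in (Node p.1 m r, p.2)
  end.

Definition graftable t s := if postorder t is b :: _ then root_lt s b else true.

Lemma seg0_node l m r : l != Leaf -> seg0 (Node l m r) = seg0 l.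
Proof. by case: l. Qed.

Lemma tail_weight_node l m r : l != Leaf ->
  tail_weight (Node l m r) = tail_weight l * (u (seg0 r) * tail_weight r).
Proof. by case: l. Qed.

Lemma graft_node l m r s : l != Leaf -> graft (Node l m r) s = Node (graft l s) m r.
Proof. by case: l. Qed.

Lemma cut_node l m r i : l != Leaf -> (0 < i)%N ->
  cut (Node l m r) i = (Node (cut l i).1 m r, (cut l i).2).
Proof. by case: l => // ? ? ? _; case: i. Qed.

Lemma cut0 t : cut t 0 = (Leaf, t).
Proof. by case: t. Qed.

Lemma graft_root l m r s : exists l' r', graft (Node l m r) s = Node l' m r'.
Proof.
have [->|lN] := eqVneq l Leaf; first by exists Leaf, (graft r s).
by rewrite graft_node //; exists (graft l s), r.
Qed.

Lemma graft_neq_Leaf t s : t != Leaf -> graft t s != Leaf.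
Proof. by case: t => // l m r _; have [l' [r' ->]] := graft_root l m r s. Qed.

Lemma seg0_gt0 t : (0 < seg0 t)%N = (t != Leaf).
Proof.
by elim/btree_left_ind: t => // l m r lN IHl _; rewrite seg0_node // IHl lN.
Qed.

(** The tree [s] is attached at the end of the first segment of [t], so the two first segments are
    joined. *)
Lemma seg0_graft t s : seg0 (graft t s) = (seg0 t + seg0 s)%N.
Proof.
elim/btree_left_ind: t => [|m r IHr|l m r lN IHl _] //; first by rewrite /= IHr.
by rewrite graft_node // !seg0_node ?graft_neq_Leaf.
Qed.

Lemma tail_weight_graft t s :
  tail_weight (graft t s) = tail_weight t * tail_weight s.
Proof.
elim/btree_left_ind: t => [|m r //|l m r lN IHl _]; first by rewrite mul1r.
by rewrite graft_node // !tail_weight_node ?graft_neq_Leaf // IHl mulrAC.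
Qed.

Lemma cut_graft t s : cut (graft t s) (seg0 t) = (t, s).
Proof.
elim/btree_left_ind: t => [|m r /= -> //|l m r lN IHl _]; first exact: cut0.
by rewrite graft_node // seg0_node // cut_node ?graft_neq_Leaf ?seg0_gt0 // IHl.
Qed.

(** With [cut_graft], pairs of trees correspond to trees with a cut position from 0 to [seg0]; the
    two extremes give an empty component. *)
Lemma graft_cut t i : (i <= seg0 t)%N ->
  graft (cut t i).1 (cut t i).2 = t /\ seg0 (cut t i).1 = i.
Proof.
elim/btree_left_ind: t i => [[]//|m r IHr [|i] //= /IHr[-> ->] //|l m r lN IHl _ i].
rewrite seg0_node //; case: (posnP i) => [->|i_gt0 /IHl[gE sE]]; first by rewrite cut0.
have cN : (cut l i).1 != Leaf by rewrite -seg0_gt0 sE.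
by rewrite cut_node // graft_node // gE seg0_node.
Qed.

Lemma inorder_graft t s :
  perm_eq (inorder (graft t s)) (inorder t ++ inorder s).
Proof.
elim/btree_left_ind: t => [|m r IHr|l m r lN IHl _] //; first by rewrite /= perm_cons.
by rewrite graft_node //= perm_sym perm_catAC perm_cat2r perm_sym.
Qed.

(** The grafting path turns right only at vertices without left child; elsewhere it changes only the
    left subtree and keeps its root. *)
Lemma quasicanonical_graft t s :
  quasicanonical (graft t s) = quasicanonical t && quasicanonical s.
Proof.
elim/btree_left_ind: t => [|m r IHr|l m r lN IHl _] //.
rewrite graft_node //= IHl -!andbA.
have -> : quasicanonical_at (graft l s) r = quasicanonical_at l r.
  case: l lN {IHl} => // l' m' r' _.
  by have [? [? ->]] := graft_root l' m' r' s.
by congr (_ && (_ && _)); rewrite andbC.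
Qed.

Lemma postorder_neq_Leaf t : t != Leaf -> exists b s, postorder t = b :: s.
Proof.
case: t => //= l m r _; rewrite catA.
by case: (postorder l ++ _) => [|b s]; [exists m, [::] | exists b, (s ++ [:: m])].
Qed.

Lemma graftable_node l m r s : l != Leaf -> graftable (Node l m r) s = graftable l s.
Proof. by rewrite /graftable => /postorder_neq_Leaf[b [s' /= ->]]. Qed.

Lemma graftable_right m r s :
  r != Leaf -> graftable (Node Leaf m r) s = graftable r s.
Proof. by rewrite /graftable => /postorder_neq_Leaf[b [s' /= ->]]. Qed.

(** The only new edge joins the root of [s] to the first vertex of [t] in postorder; [graftable] is
    the condition on this edge. *)
Lemma decreasing_graft t s :
  decreasing (graft t s) = [&& decreasing t, decreasing s & graftable t s].
Proof.
have root_graft t' m : t' != Leaf -> root_lt (graft t' s) m = root_lt t' m.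
  by case: t' => // l m' r _; have [? [? ->]] := graft_root l m' r s.
elim/btree_left_ind: t => [|m r IHr|l m r lN IHl _]; first by rewrite /= andbT.
  rewrite /= IHr; have [->/=|rN] := eqVneq r Leaf; first by rewrite andbT andbC.
  rewrite root_graft // -andbA; congr [&& _, _, _ & _].
  by rewrite graftable_right.
rewrite graft_node // graftable_node //= IHl root_graft //.
by rewrite -!andbA; do !bool_congr.
Qed.

End Weights.

(** * The vector q^T under removal of the root *)

Lemma decreasing_lt t m :
  decreasing t -> root_lt t m -> all (fun i => i < m)%N (inorder t).
Proof.
elim: t m => //= l IHl a r IHr m /and4P[la ra dl dr] am.
rewrite all_cat /= am IHl ?IHr //=; [case: r ra {IHr dr}|case: l la {IHl dl}];
  by move=> //= _ b _ /ltn_trans; apply.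
Qed.

Lemma inorder_neq_Leaf t : t != Leaf -> exists a s, inorder t = a :: s.
Proof.
case: t => //= l m r _.
by case: (inorder l) => [|a s]; [exists m, (inorder r) | exists a, (s ++ m :: inorder r)].
Qed.

Lemma pairmap_shift k a s :
  pairmap (fun r r' => r' - r - 1)%N (k + a)%N [seq (k + i)%N | i <- s] =
  pairmap (fun r r' => r' - r - 1)%N a s.
Proof. by elim: s a => //= b s IHs a; rewrite IHs subnDl. Qed.

(** The root opens the word without being a peak, so all peaks move by one. *)
Lemma qvec_leftless m r : all (fun i => i < m)%N (inorder r) ->
  qvec (Node Leaf m r) = (head 0 (qvec r)).+1%N :: behead (qvec r).
Proof.
move=> ltrm; rewrite /qvec /= !peaksE peaks_from_max // (peaks_from_shift 2 1).
rewrite -[(size _).+2]add1n -map_rcons.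
(* The peaks followed by the end marker start with a positive number, so truncated subtraction is
   exact in the first entry. *)
have [b [s ->]] : exists b s,
    rcons (peaks_from 2 (inorder r)) (size (inorder r)).+1 = b.+1 :: s.
  rewrite peaks_fromE; case: [seq _ <- _ | _] => [|j js]; first by do 2!eexists.
  by exists j.+1; eexists.
by rewrite /= pairmap_shift !subn0 !subn1 add1n.
Qed.

(** The root is a peak whose position equals the end marker for [l], and the peaks of [r] are
    shifted by that position. *)
Lemma qvec_node l m r : l != Leaf -> r != Leaf ->
    all (fun i => i < m)%N (inorder l) -> all (fun i => i < m)%N (inorder r) ->
  qvec (Node l m r) = qvec l ++ qvec r.
Proof.
move=> /inorder_neq_Leaf[a [s Es]] /inorder_neq_Leaf[b [s' Es']].
rewrite /qvec /= !peaksE Es Es' => ltsm lts'm.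
rewrite peaks_from_cat // rcons_cat rcons_cons -cat_rcons pairmap_cat last_rcons.
congr (_ ++ _).
have -> : (size ((a :: s) ++ m :: b :: s')).+1 = ((2 + size s) + (size (b :: s')).+1)%N.
  by rewrite size_cat /= !addSn !addnS.
have -> : (2 + size s).+2 = ((2 + size s) + 2)%N by rewrite addn2.
by rewrite peaks_from_shift -map_rcons -{1}[(2 + size s)%N]addn0 pairmap_shift.
Qed.

Lemma mem_postorder t : postorder t =i inorder t.
Proof.
elim: t => //= l IHl m r IHr k.
by rewrite !mem_cat !inE IHl IHr; congr (_ || _); rewrite orbC.
Qed.

(** * Sums over quasicanonical trees *)

Section TreeSums.
Variables (K : comPzRingType) (u : nat -> K).

Lemma qvec_weight t : decreasing t -> quasicanonical t ->
  exists2 qs, qvec t = seg0 t :: qs & \prod_(q <- qs) u q = tail_weight u t.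
Proof.
elim/btree_left_ind: t => [|m r IHr|l m r lN IHl IHr] /=.
- by exists [::]; rewrite ?big_nil.
- case/andP=> rm dr qr; have [qs Eqs <-] := IHr dr qr.
  by exists qs => //; rewrite qvec_leftless ?decreasing_lt // Eqs.
case/and4P=> lm rm dl dr /and3P[qlr ql qr].
have [qs Eqs Ews] := IHl dl ql; have [qs' Eqs' Ews'] := IHr dr qr.
(* Quasicanonicity makes the right subtree nonempty, hence the root a peak. *)
have rN : r != Leaf.
  case: r qlr {IHr rm dr qr Eqs' Ews'} => //.
  by case: l lN {IHl lm dl ql Eqs Ews}.
exists (qs ++ seg0 r :: qs').
  by rewrite qvec_node ?decreasing_lt // Eqs Eqs' -/(seg0 (Node l m r)) seg0_node.
by rewrite -/(tail_weight u (Node l m r)) tail_weight_node // big_cat big_cons Ews Ews'.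
Qed.

Section Labels.
Variable M : nat.
Implicit Types (A X Y : {set 'I_M}) (s t : btree) (w : nat -> K).

(** The index [i] stands for the label [i.+1]. Subtrees carry arbitrary label sets, so the recursion
    is run over subsets of ['I_M]. *)
Definition labels X : seq nat := [seq i.+1 | i : 'I_M <- enum X].

Lemma labels_uniq X : uniq (labels X).
Proof. by rewrite map_inj_uniq ?enum_uniq // => i j [] /val_inj. Qed.

Lemma mem_labels X (i : 'I_M) : (i.+1 \in labels X) = (i \in X).
Proof.
by rewrite -(mem_enum X) -(mem_map (f := fun i : 'I_M => i.+1)) // => j k [] /val_inj.
Qed.

Lemma labelsP X k : reflect (exists2 i : 'I_M, i \in X & k = i.+1) (k \in labels X).
Proof.
by apply: (iffP mapP) => -[i]; rewrite ?mem_enum => Xi ->; exists i; rewrite ?mem_enum.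
Qed.

Definition trees : seq btree := undup (dtrees M).

Lemma mem_trees X t : qcan_on (labels X) t -> t \in trees.
Proof.
case/andP=> /andP[tX dt] _; rewrite mem_undup mem_dtrees //.
  by rewrite (perm_all _ tX); apply/allP => k /labelsP[i _ ->].
case: t tX {dt} => //= l m r /perm_mem/(_ m); rewrite mem_cat mem_head orbT.
by case/esym/labelsP=> i _ ->; rewrite ltnS.
Qed.

Definition tree_sum w X : K := \sum_(t <- trees | qcan_on (labels X) t) weight u w t.

Lemma tree_sum0 w : tree_sum w set0 = w 0%N.
Proof.
rewrite /tree_sum (big_rem Leaf) /=; last first.
  by apply: (@mem_trees set0); rewrite /labels enum_set0.
rewrite {1}/labels enum_set0 /= [weight _ _ _]mulr1 big1_seq ?addr0 // => t.
case/andP=> /andP[/andP[]]; rewrite /labels enum_set0 => /perm_nilP tN _ _.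
rewrite mem_rem_uniq ?undup_uniq // inE => /andP[tL _].
by have [? [?]] := inorder_neq_Leaf tL; rewrite tN.
Qed.

Definition tree_pairs := [seq (s, t) | s <- trees, t <- trees].

Definition qcan_pair A (p : btree * btree) :=
  [&& perm_eq (inorder p.1 ++ inorder p.2) (labels A), decreasing p.1,
      decreasing p.2, quasicanonical p.1 & quasicanonical p.2].

Definition label_set t : {set 'I_M} := [set i : 'I_M | i.+1 \in inorder t].

Lemma qcan_pair_split A Y s t : Y \subset A ->
  qcan_pair A (s, t) && (label_set s == Y) =
  qcan_on (labels Y) s && qcan_on (labels (A :\: Y)) t.
Proof.
move=> YA; rewrite /qcan_pair /qcan_on /decreasing_on /=.
have permE : perm_eq (inorder s ++ inorder t) (labels A) && (label_set s == Y) =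
    perm_eq (inorder s) (labels Y) && perm_eq (inorder t) (labels (A :\: Y)).
  apply/andP/andP => [[stA /eqP sY]|[sY tAY]].
    have := perm_uniq stA; rewrite labels_uniq cat_uniq => /and3P[us /hasPn st ut].
    have memY (i : 'I_M) : (i.+1 \in inorder s) = (i \in Y) by rewrite -sY inE.
    split; apply: uniq_perm; rewrite ?labels_uniq // => k; apply/idP/labelsP.
    - move=> ks; have : k \in labels A by rewrite -(perm_mem stA) mem_cat ks.
      by case/labelsP=> i _ ki; exists i; rewrite // -memY -ki.
    - by case=> i iY ->; rewrite memY.
    - move=> kt; have : k \in labels A by rewrite -(perm_mem stA) mem_cat kt orbT.
      by case/labelsP=> i Ai ki; exists i; rewrite // inE Ai -memY -ki st.
    case=> i; rewrite inE -memY => /andP[/negbTE is_ Ai] ->.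
    by have := perm_mem stA i.+1; rewrite mem_cat is_ mem_labels Ai.
  split; last by apply/eqP/setP => i; rewrite inE (perm_mem sY) mem_labels.
  rewrite (perm_trans (perm_cat sY tAY)) //.
  apply: uniq_perm => [|| k]; rewrite ?labels_uniq ?cat_uniq ?labels_uniq ?andbT //=.
    apply/hasPn => _ /labelsP[i + ->]; rewrite mem_labels inE.
    by case/andP.
  rewrite mem_cat; apply/orP/labelsP => [[]/labelsP[i]|[i Ai ->]].
  - by move=> /(subsetP YA) Ai ->; exists i.
  - by rewrite inE => /andP[_ Ai] ->; exists i.
  by rewrite !mem_labels inE Ai andbT; case: (i \in Y); [left | right].
by rewrite andbAC permE -!andbA; do !bool_congr.
Qed.

Lemma mem_tree_pairs A p : qcan_pair A p -> p \in tree_pairs.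
Proof.
case: p => s t pA; have : qcan_pair A (s, t) && (label_set s == label_set s).
  by rewrite pA eqxx.
rewrite qcan_pair_split.
  by case/andP=> /mem_trees sT /mem_trees tT; apply: allpairs_f.
case/and5P: pA => /perm_mem pA _ _ _ _; apply/subsetP => i; rewrite inE => pi.
by rewrite -mem_labels -pA mem_cat pi.
Qed.

Lemma sum_qcan_pair A (F : btree -> btree -> K) :
  \sum_(p <- tree_pairs | qcan_pair A p) F p.1 p.2 =
  \sum_(Y : {set 'I_M} | Y \subset A)
     \sum_(s <- trees | qcan_on (labels Y) s)
        \sum_(t <- trees | qcan_on (labels (A :\: Y)) t) F s t.
Proof.
rewrite (partition_big (fun p => label_set p.1) (fun Y => Y \subset A)) => [|p]; last first.
  case/and5P=> /perm_mem pA _ _ _ _; apply/subsetP => i; rewrite inE => pi.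
  by rewrite -mem_labels -pA mem_cat pi.
apply: eq_bigr => Y YA; rewrite big_mkcond big_allpairs /= [RHS]big_mkcond.
apply: eq_bigr => s _; rewrite -big_mkcond /=.
under eq_bigl do rewrite qcan_pair_split //.
case: (qcan_on (labels Y) s) => //=; exact: big_pred0_eq.
Qed.

(* The pairs (L, R) that do not occur as the two nonempty subtrees of a vertex. *)
Definition bad_pair (p : btree * btree) :=
  (p.1 == Leaf) || ~~ quasicanonical_at p.1 p.2.

(** Failure of the condition means that the root of the first tree is at most the first postorder
    letter of the second; equality is excluded because the labels are distinct. *)
Lemma bad_pairE A p : qcan_pair A p -> bad_pair p = graftable p.2 p.1.
Proof.
case: p => s t /and5P[/= pA _ _ _ _]; rewrite /bad_pair /graftable /=.
case: s pA => [|l a r] /= pA; first by case: (postorder t).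
have [->//|/postorder_neq_Leaf[b [s' Et]]] := eqVneq t Leaf; rewrite Et.
rewrite -leqNgt leq_eqVlt; case: eqP => // Eab.
have := perm_uniq pA; rewrite labels_uniq cat_uniq => /and3P[_ /hasPn/(_ b) + _].
rewrite -mem_postorder Et mem_head Eab mem_cat mem_head orbT => /(_ isT); by [].
Qed.

Definition tree_cuts := [seq (t, i) | t <- trees, i <- iota 0 (seg0 t).+1].

(** Grafting turns bad pairs into trees with a cut in the first segment; summing over the cut
    position gives the Cauchy product at [seg0]. *)
Lemma sum_bad_pair A w :
  \sum_(p <- tree_pairs | qcan_pair A p && bad_pair p) weight u w p.1 * weight u u p.2 =
  tree_sum (cauchy_prod w u) A.
Proof.
transitivity (\sum_(q <- tree_cuts | qcan_on (labels A) q.1)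
   w (seg0 q.1 - q.2)%N * u q.2 * tail_weight u q.1).
  pose f (p : btree * btree) := (graft p.2 p.1, seg0 p.2).
  pose g (q : btree * nat) := ((cut q.1 q.2).2, (cut q.1 q.2).1).
  have good p : qcan_pair A p && bad_pair p = qcan_on (labels A) (graft p.2 p.1).
    apply: (@etrans _ _ (qcan_pair A p && graftable p.2 p.1)).
      by apply: andb_id2l => /bad_pairE.
    rewrite /qcan_pair /qcan_on /decreasing_on decreasing_graft quasicanonical_graft.
    rewrite (permPl (inorder_graft _ _)) perm_catC -!andbA; congr (_ && _).
    by do !bool_congr.
  apply: (big_seq_bij (f := f) (g := g)).
  - by apply: allpairs_uniq; rewrite ?undup_uniq // => -[? ?] [? ?] _ _ [-> ->].
  - apply: allpairs_uniq_dep => [|t _|[t i] [t' i'] _ _ /= [-> ->] //].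
      exact: undup_uniq.
    exact: iota_uniq.
  - case=> s t _; rewrite good => /= st; split=> //; last 1 first.
    + rewrite /weight seg0_graft addKn tail_weight_graft /=.
      by rewrite mulrACA [tail_weight u s * _]mulrC.
    + apply/allpairsPdep; exists (graft t s), (seg0 t); split=> //.
        exact: mem_trees st.
      by rewrite mem_iota seg0_graft /= add0n ltnS leq_addr.
    + by rewrite /g /f cut_graft.
  case=> t i /allpairsPdep[t' [i' [_ + [-> ->]]]] {t i}.
  rewrite mem_iota add0n ltnS => /andP[_ /graft_cut[gE sE]] /= tA.
  rewrite good /f gE sE; split=> //; apply: (@mem_tree_pairs A).
  suff /andP[] : qcan_pair A (g (t', i')) && bad_pair (g (t', i')) by [].
  by rewrite good gE.
rewrite big_mkcond big_allpairs_dep /= [RHS]big_mkcond; apply: eq_bigr => t _.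
case: ifP => _; last by rewrite big1.
rewrite /weight /cauchy_prod big_distrl /=.
by rewrite -(big_mkord xpredT (fun i => w (seg0 t - i)%N * u i * tail_weight u t)).
Qed.

(** The root of a decreasing tree carries the largest label. *)
Lemma qcan_on_node X x l m r : x \in X -> (forall i, i \in X -> (i <= x)%N) ->
  qcan_on (labels X) (Node l m r) =
  [&& m == x.+1, quasicanonical_at l r & qcan_pair (X :\ x) (l, r)].
Proof.
move=> Xx maxx; rewrite /qcan_on /decreasing_on /qcan_pair /=.
have labX : perm_eq (labels X) (x.+1 :: labels (X :\ x)).
  apply: uniq_perm; rewrite /= ?labels_uniq ?mem_labels ?inE ?eqxx // => k.
  rewrite inE; apply/labelsP/predU1P => [[i Xi ->]|[->|/labelsP[i + ->]]].
  - have [->|ix] := eqVneq i x; first by left.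
    by right; rewrite mem_labels !inE ix.
  - by exists x.
  by rewrite inE => /andP[_ Xi]; exists i.
rewrite perm_sym (permPl labX) perm_sym perm_catC /= perm_sym.
apply/idP/idP.
  case/andP=> /andP[pX /and4P[lm rm dl dr]] /and3P[qlr ql qr].
  have /eqP mx : m == x.+1.
    rewrite eqn_leq; have mX : m \in labels X.
      by rewrite (perm_mem labX) (perm_mem pX) mem_head.
    have {mX} [i Xi mi] := labelsP _ _ mX.
    rewrite mi ltnS maxx //=.
    have := perm_mem pX x.+1; rewrite mem_head => /esym.
    rewrite -mi inE mem_cat => /or3P[/eqP-> //| |].
      by move/(allP (decreasing_lt dr rm))/ltnW.
    by move/(allP (decreasing_lt dl lm))/ltnW.
  move: pX; rewrite mx perm_cons eqxx qlr dl dr ql qr /= perm_sym perm_catC => ->.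
  by [].
case/and3P=> /eqP-> -> /and5P[plr dl dr -> ->]; rewrite dl dr !andbT.
rewrite perm_cons perm_sym perm_catC plr /=.
have ltlr : all (fun k => k < x.+1)%N (inorder l ++ inorder r).
  rewrite (perm_all _ plr); apply/allP => _ /labelsP[i + ->]; rewrite !inE.
  by case/andP=> ix Xi; rewrite ltnS ltn_neqAle val_eqE ix maxx.
have root_all t : all (fun k => k < x.+1)%N (inorder t) -> root_lt t x.+1.
  by case: t => //= ? ? ?; rewrite all_cat => /and3P[].
by move: ltlr; rewrite all_cat => /andP[/root_all-> /root_all->].
Qed.

Lemma tree_sum_rec w X x : x \in X -> (forall i, i \in X -> (i <= x)%N) ->
  tree_sum w X = tree_sum (fun k => w k.+1) (X :\ x)
    + \sum_(Y : {set 'I_M} | Y \subset X :\ x) tree_sum w Y * tree_sum u (X :\ x :\: Y)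
    - tree_sum (cauchy_prod w u) (X :\ x).
Proof.
move=> Xx maxx; rewrite -sum_bad_pair.
have <- : \sum_(p <- tree_pairs | qcan_pair (X :\ x) p) weight u w p.1 * weight u u p.2 =
  \sum_(Y : {set 'I_M} | Y \subset X :\ x) tree_sum w Y * tree_sum u (X :\ x :\: Y).
  rewrite (sum_qcan_pair _ (fun s t => weight u w s * weight u u t)).
  by apply: eq_bigr => Y _; rewrite big_distrlr.
(* The bad pairs cancel; only pairs that occur as two nonempty subtrees remain. *)
rewrite [in RHS](bigID bad_pair) /= -addrA [X in _ + (X - _)]addrC addrK.
pose leftless t := if t is Node Leaf _ _ then true else false.
rewrite /tree_sum (bigID leftless) /=; congr (_ + _).
  (* Without a left subtree, removing the root lowers the first entry by one. *)
  pose f t := if t is Node _ _ r then r else Leaf.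
  apply: (big_seq_bij (f := f) (g := Node Leaf x.+1)); rewrite ?undup_uniq //.
  - case=> [|[|l k l'] m r] _; rewrite ?andbF // andbT (qcan_on_node _ _ _ Xx maxx).
    case/and3P=> /eqP-> _ /and5P[/= pr _ dr _ qr].
    have rX : qcan_on (labels (X :\ x)) r by rewrite /qcan_on /decreasing_on pr dr.
    by split=> //; apply: mem_trees rX.
  move=> r _ rX; have XN : qcan_on (labels X) (Node Leaf x.+1 r).
    rewrite (qcan_on_node _ _ _ Xx maxx) eqxx /=.
    by case/andP: rX => /andP[? ?] ?; apply/and5P.
  by rewrite /= andbT; split=> //; apply: mem_trees XN.
(* With two subtrees, the first entry comes from the left one, and the right one is weighted by [u]
   throughout. *)
pose f t := if t is Node l _ r then (l, r) else (Leaf, Leaf).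
apply: (big_seq_bij (f := f) (g := fun p => Node p.1 x.+1 p.2)).
- by rewrite undup_uniq.
- by apply: allpairs_uniq; rewrite ?undup_uniq // => -[? ?] [? ?] _ _ [-> ->].
- case=> [|l m r] _ /andP[].
    rewrite /qcan_on /decreasing_on => /andP[/andP[+ _] _].
    by move/perm_mem/(_ x.+1); rewrite mem_labels Xx.
  rewrite (qcan_on_node _ _ _ Xx maxx) => /and3P[/eqP-> qlr lrX] lN.
  have {}lN : l != Leaf by case: l lN {qlr lrX}.
  split=> //; first exact: mem_tree_pairs lrX.
    by rewrite lrX /bad_pair /= (negbTE lN) qlr.
  by rewrite /weight seg0_node // tail_weight_node // !mulrA.
case=> l r _ /andP[lrX]; rewrite /bad_pair /= negb_or negbK => /andP[lN qlr].
have XN : qcan_on (labels X) (Node l x.+1 r).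
  by rewrite (qcan_on_node _ _ _ Xx maxx) eqxx qlr.
by split=> //; [exact: mem_trees XN|rewrite XN; case: l lN {qlr XN lrX}].
Qed.

End Labels.
End TreeSums.

(** * Tree sums as functions of the number of labels *)

Section QcanSum.
Variables (K : comPzRingType) (u : nat -> K).

Definition qcan_sum n (w : nat -> K) : K := tree_sum u w [set: 'I_n].

Lemma qcan_sum0 w : qcan_sum 0 w = w 0%N.
Proof. by rewrite /qcan_sum (_ : setT = set0) ?tree_sum0 //; apply/setP => -[]. Qed.

(** As for partitions, the assumption on smaller sets is an induction hypothesis, used by
    [tree_sum_card]. *)
Lemma tree_sum_hconv M (X : {set 'I_M}) n w : #|X| = n.+1 ->
    (forall (Y : {set 'I_M}) w', (#|Y| <= n)%N -> tree_sum u w' Y = qcan_sum #|Y| w') ->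
  tree_sum u w X = qcan_sum n (fun k => w k.+1)
    + hconv (fun k => qcan_sum k w) (fun k => qcan_sum k u) n
    - qcan_sum n (cauchy_prod w u).
Proof.
move=> cardX IH; have /card_gt0P[x0 Xx0] : (0 < #|X|)%N by rewrite cardX.
case: (arg_maxnP (fun i : 'I_M => val i) Xx0) => x Xx maxx.
have cardXx : #|X :\ x| = n.
  by move: (cardsD1 x X); rewrite (Xx : x \in X) cardX; case.
rewrite (@tree_sum_rec _ _ _ _ _ x) // !IH ?cardXx //; congr (_ + _ - _).
rewrite -cardXx -sum_subset_hconv; apply: eq_bigr => Y sY.
by rewrite !IH // -cardXx subset_leq_card // subsetDl.
Qed.

Lemma tree_sum_card M (X : {set 'I_M}) w : tree_sum u w X = qcan_sum #|X| w.
Proof.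
have [n] := ubnP #|X|; elim: n M X w => // n IHn M X w.
case cardX: #|X| => [|k]; rewrite ltnS => le_k_n.
  by rewrite (cards0_eq cardX) tree_sum0 qcan_sum0.
rewrite (tree_sum_hconv _ cardX) => [|Y w' leY]; last by rewrite IHn //; lia.
rewrite /qcan_sum -(@tree_sum_hconv _ [set: 'I_k.+1]) ?cardsT ?card_ord // => Y w' leY.
by rewrite IHn //; lia.
Qed.

Lemma qcan_sumS n w :
  qcan_sum n.+1 w = qcan_sum n (fun k => w k.+1)
    + hconv (fun k => qcan_sum k w) (fun k => qcan_sum k u) n
    - qcan_sum n (cauchy_prod w u).
Proof.
rewrite -(@tree_sum_hconv _ [set: 'I_n.+1]) ?cardsT ?card_ord // => Y w' _.
exact: tree_sum_card.
Qed.

Lemma qcan_sumB n w1 w2 :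
  qcan_sum n (fun k => w1 k - w2 k) = qcan_sum n w1 - qcan_sum n w2.
Proof. by rewrite -sumrB; apply: eq_bigr => t _; rewrite /weight mulrBl. Qed.

Lemma qcan_sumN n w : qcan_sum n (fun k => - w k) = - qcan_sum n w.
Proof. by rewrite -sumrN; apply: eq_bigr => t _; rewrite /weight mulNr. Qed.

Lemma sum_Qcan n :
  \sum_(T : Qcan n) \prod_(q <- qvec T) u q = qcan_sum n u.
Proof.
have labelsT : labels [set: 'I_n] = iota 1 n.
  rewrite /labels enum_setT -enumT -[1%N]addn0 iotaDl -val_enum_ord -map_comp.
  by apply: eq_map.
pose qprod t := \prod_(q <- qvec t) u q.
rewrite /qcan_sum /tree_sum labelsT -(big_map (@qcan_tree n) xpredT qprod).
rewrite -[RHS]big_filter.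
transitivity (\sum_(t <- [seq t <- trees n | qcan_on (iota 1 n) t]) qprod t); last first.
  apply: eq_big_seq => t; rewrite mem_filter /qprod.
  case/andP=> /andP[/andP[_ dt] qt] _.
  by have [qs -> wt] := qvec_weight u dt qt; rewrite big_cons wt.
apply/perm_big/uniq_perm.
- by rewrite map_inj_uniq ?index_enum_uniq //; apply: val_inj.
- by rewrite filter_uniq ?undup_uniq.
move=> t; rewrite mem_filter; apply/mapP/andP => [[T _ ->]|[qt _]].
  have qT := valP T; split=> //; apply: (@mem_trees _ [set: 'I_n]).
  by rewrite labelsT.
by exists (Sub t qt); rewrite ?mem_index_enum.
Qed.

End QcanSum.

Theorem corollary4p2 (K : fieldType) (kappa c : nat -> K)
    (hc : classical_cumulants_of_free kappa c) (n : nat) (hn : (0 < n)%N) :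
  - c n = \sum_(T : Qcan n.-1) \prod_(q <- qvec T) (- kappa q.+1).
Proof.
pose u k := - kappa k.+1; pose a w k := qcan_sum u k w.
(* The candidate cumulants [c'] define moments [m], to be compared with the free moments. *)
pose c' k := - a u k.-1; pose m := moment_of_classical c'.
have mS k : m k.+1 = - hconv (a u) m k by rewrite /m moment_of_classicalS -hconvNl.
pose F k w := hconv (a w) m k.
have F0 w : F 0%N w = w 0%N.
  by rewrite /F hconv0 /a qcan_sum0 /m moment_of_classical0 mulr1.
have FS k w : F k.+1 w = F k (fun i => w i.+1 - cauchy_prod w u i).
  rewrite /F hconvS.
  rewrite (eq_hconv (fun i _ => qcan_sumS u i w) (fun i _ => erefl (m i))).
  rewrite (eq_hconv (fun i _ => erefl (a w i)) (fun i _ => mS i)) hconvNr.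
  rewrite [RHS](eq_hconv (fun i _ => qcan_sumB u i _ _) (fun i _ => erefl (m i))).
  (* By associativity the quadratic terms from [qcan_sumS] and from [mS] are opposite and cancel. *)
  by rewrite !hconvDl !hconvNl hconvA addrAC addrK.
have eq_m k : (0 < k)%N -> moment_of_classical c k = m k.
  case: k => // k _; rewrite -hc // moment_of_freeS (nc_sum_iter F0 FS).
  (* The weight of the first block is [- u], so linearity in [w] turns [F k] into the right-hand
     side of [mS]. *)
  rewrite subn1 /= mS -hconvNl; apply: eq_hconv => // i _.
  by rewrite /a -qcan_sumN; apply: eq_bigr => t _; rewrite /weight /u opprK.
by rewrite (eq_classical_cumulants eq_m hn) /c' opprK /a -sum_Qcan.
Qed.
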